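(* Let $n,p,L\in\mathbb{Z}_{\ge 1}$, $\boldsymbol{A}\in\mathbb{R}^{n\times n}$, $\boldsymbol{C}\in\mathbb{R}^{p\times n}$, $\boldsymbol{e}_o\in\mathbb{R}^n$, $\boldsymbol{r}_o\in\mathbb{R}^p$, and consider the linear autonomous system with offsets $$\boldsymbol{x}(t+1)=\boldsymbol{A}\boldsymbol{x}(t)+\boldsymbol{e}_o,\qquad \boldsymbol{y}(t)=\boldsymbol{C}\boldsymbol{x}(t)+\boldsymbol{r}_o .\tag{S}$$ Let $T\ge L+n$ and suppose that the data sequence $\{\boldsymbol{x}_{[0,T]},\boldsymbol{y}_{[0,T-1]}\}$ is a trajectory of (S) satisfying the rank condition $$\mathrm{rank}\begin{bmatrix}\boldsymbol{H}_1(\boldsymbol{x}_{[0,T-L]})\\ \boldsymbol{1}_{T-L+1}^{\top}\end{bmatrix}=n+1 .$$ Then a data sequence $\{\boldsymbol{x}'_{[0,L]},\boldsymbol{y}'_{[0,L-1]}\}$ (with $\boldsymbol{x}'(i)\in\mathbb{R}^n$, $\boldsymbol{y}'(i)\in\mathbb{R}^p$) is a trajectory of (S) if and only if there exists $\boldsymbol{\alpha}\in\mathbb{R}^{T-L+1}$ such that $$\begin{bmatrix}\boldsymbol{H}_{L+1}(\boldsymbol{x}_{[0,T]})\\ \boldsymbol{H}_{L}(\boldsymbol{y}_{[0,T-1]})\\ \boldsymbol{1}_{T-L+1}^{\top}\end{bmatrix}\boldsymbol{\alpha}=\begin{bmatrix}\boldsymbol{x}'_{[0,L]}\\ \boldsymbol{y}'_{[0,L-1]}\\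 1\end{bmatrix}.$$
   Context: For a vector sequence, $\boldsymbol{u}_{[i,j]}=[\boldsymbol{u}(i)^\top\ \boldsymbol{u}(i+1)^\top\cdots\boldsymbol{u}(j)^\top]^\top$ denotes the stacked column vector. The Hankel matrix of depth $k\ge 1$ of $\boldsymbol{u}_{[i,j]}$ is $$\boldsymbol{H}_k(\boldsymbol{u}_{[i,j]})=\begin{bmatrix}\boldsymbol{u}(i)&\boldsymbol{u}(i+1)&\cdots&\boldsymbol{u}(j-k+1)\\ \boldsymbol{u}(i+1)&\boldsymbol{u}(i+2)&\cdots&\boldsymbol{u}(j-k+2)\\ \vdots&\vdots&\ddots&\vdots\\ \boldsymbol{u}(i+k-1)&\boldsymbol{u}(i+k)&\cdots&\boldsymbol{u}(j)\end{bmatrix}.$$ $\boldsymbol{1}_m$ is the all-ones column vector in $\mathbb{R}^m$. A data sequence $\{\boldsymbol{x}_{[0,N]},\boldsymbol{y}_{[0,N-1]}\}$ is a trajectory of (S) if $\boldsymbol{x}(t+1)=\boldsymbol{A}\boldsymbol{x}(t)+\boldsymbol{e}_o$ and $\boldsymbol{y}(t)=\boldsymbol{C}\boldsymbol{x}(t)+\boldsymbol{r}_o$ hold for all $t=0,\dots,N-1$. *)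

(* Defs.v *)
From mathcomp Require Import all_boot all_order all_algebra.
From mathcomp Require Import reals.

Set Implicit Arguments.
Unset Strict Implicit.
Unset Printing Implicit Defensive.

Import GRing.Theory.
Local Open Scope ring_scope.

(* Vector signals are indexed by all of [nat], but only a window of finite
   length is ever read.  A window is given by its first index [i] and its
   length [N]: it is u_[i, i + N - 1], so that u_[0, T] is [i = 0], [N = T.+1]
   and u_[0, T - 1] is [i = 0], [N = T]. *)

Definition stack (R : realType) (m : nat) (u : nat -> 'cV[R]_m) (i N : nat) :
    'cV[R]_(\sum_(r < N) m) :=
  \mxcol_(r < N) u (i + r)%N.

(* Block row [r], column [c] is u(i + r + c).  There are N - k + 1 columns, the
   last one ending in u(i + N - 1).  Meaningful for 1 <= k <= N only: since
   subtraction is truncated, for k > N one column leaving the window remains. *)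
Definition hankel (R : realType) (m k : nat) (u : nat -> 'cV[R]_m) (i N : nat) :
    'M[R]_(\sum_(r < k) m, (N - k).+1) :=
  \mxcol_(r < k) \matrix_(a < m, c < (N - k).+1) u (i + r + c)%N a 0.

Definition is_trajectory (R : realType) (n p : nat)
    (A : 'M[R]_n) (C : 'M[R]_(p, n)) (eo : 'cV[R]_n) (ro : 'cV[R]_p)
    (N : nat) (x : nat -> 'cV[R]_n) (y : nat -> 'cV[R]_p) : Prop :=
  forall t : nat, (t < N)%N ->
    x t.+1 = A *m x t + eo /\ y t = C *m x t + ro.

(* Main.v *)
Require Import Defs.
From mathcomp Require Import all_boot all_order all_algebra.
From mathcomp Require Import reals.

Set Implicit Arguments.
Unset Strict Implicit.
Unset Printing Implicit Defensive.

Import GRing.Theory.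
Local Open Scope ring_scope.

(* A combination of the length-L windows of the data whose coefficients sum to
   1 is an affine combination of trajectories, hence a trajectory.  Conversely
   a trajectory is determined by its initial state, and the rank condition says
   that every initial state is an affine combination of x(0), ..., x(T - L). *)

(** A product of a Hankel matrix with [a], read as a signal. It is defined at every [t], so
    [is_trajectory] applies to it directly. *)
Definition shift_comb (R : realType) (m N : nat) (a : 'cV[R]_N)
    (u : nat -> 'cV[R]_m) (t : nat) : 'cV[R]_m :=
  \sum_(c < N) a c 0 *: u (t + c)%N.

Lemma hankel_mul (R : realType) (m k : nat) (u : nat -> 'cV[R]_m) (i N : nat)
    (a : 'cV[R]_(N - k).+1) :
  hankel k u i N *m a = stack (shift_comb a u) i k.
Proof.
rewrite /hankel /stack mxcol_mul; apply: eq_mxcol => r.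
apply/matrixP => b j; rewrite ord1 !mxE summxE.
by apply: eq_bigr => c _; rewrite !mxE mulrC.
Qed.

Lemma eq_stackP (R : realType) (m : nat) (u v : nat -> 'cV[R]_m) (i N : nat) :
  stack u i N = stack v i N <->
  forall t, (t < N)%N -> u (i + t)%N = v (i + t)%N.
Proof.
rewrite /stack; split=> [/eq_mxcolP uv t tN | uv].
  exact: uv (Ordinal tN).
by apply: eq_mxcol => r; apply: uv.
Qed.

Lemma const_mx1_mulP (R : realType) (N : nat) (a : 'cV[R]_N) :
  (const_mx 1 : 'rV[R]_N) *m a = (const_mx 1 : 'cV[R]_1) <->
  \sum_(c < N) a c 0 = 1.
Proof.
have mulE : ((const_mx 1 : 'rV[R]_N) *m a) 0 0 = \sum_(c < N) a c 0.
  by rewrite mxE; apply: eq_bigr => c _; rewrite mxE mul1r.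
split=> [aE | sum_a]; first by rewrite -mulE aE mxE.
by apply/matrixP => i j; rewrite !ord1 mulE mxE.
Qed.

(** The matrix has [n + 1] rows, so it has full row rank and a right inverse [B]; the weights are
    [B] applied to [x0] stacked over 1. *)
Lemma affine_span (R : realType) (n N : nat) (x : nat -> 'cV[R]_n) :
  \rank (col_mx (hankel 1 x 0 N.+1) (const_mx 1 : 'rV[R]_(_))) = n.+1 ->
  forall x0 : 'cV[R]_n, exists2 a : 'cV[R]_N.+1,
    shift_comb a x 0 = x0 & \sum_(c < N.+1) a c 0 = 1.
Proof.
move=> rk x0.
(* The Hankel matrix has [(N.+1 - 1).+1] columns, equal to [N.+1] but not by computation. *)
suff: exists2 a : 'cV[R]_(N.+1 - 1).+1,
    shift_comb a x 0 = x0 & \sum_(c < (N.+1 - 1).+1) a c 0 = 1.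
  by rewrite subn1.
set M := col_mx _ _ in rk.
have /row_freeP[B MB] : row_free M by rewrite /row_free rk big_ord1 addn1.
pose v := col_mx (stack (fun=> x0) 0 1) (const_mx 1 : 'cV[R]_1).
have : M *m (B *m v) = v by rewrite mulmxA MB mul1mx.
rewrite mul_col_mx hankel_mul => /eq_col_mx[/eq_stackP x0E /const_mx1_mulP sumE].
by exists (B *m v) => //; apply: (x0E 0%N).
Qed.

Lemma shift_comb_trajectory (R : realType) (n p : nat)
    (A : 'M[R]_n) (C : 'M[R]_(p, n)) (eo : 'cV[R]_n) (ro : 'cV[R]_p)
    (L M : nat) (x : nat -> 'cV[R]_n) (y : nat -> 'cV[R]_p) (a : 'cV[R]_M.+1) :
  is_trajectory A C eo ro (L + M) x y -> \sum_(c < M.+1) a c 0 = 1 ->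
  is_trajectory A C eo ro L (shift_comb a x) (shift_comb a y).
Proof.
move=> hxy sum_a t tL.
have tcL (c : 'I_M.+1) : (t + c < L + M)%N.
  by rewrite -addSn leq_add // -ltnS ltn_ord.
(* An affine map commutes with combinations of total weight 1: [b] is split as the sum of the
   [a c 0 *: b]. Used for both [(A, eo)] and [(C, ro)]. *)
have comb_affine q (D : 'M[R]_(q, n)) (b : 'cV[R]_q) :
    D *m shift_comb a x t + b = \sum_c a c 0 *: (D *m x (t + c)%N + b).
  rewrite -[b in LHS]scale1r -sum_a scaler_suml mulmx_sumr -big_split /=.
  by apply: eq_bigr => c _; rewrite -scalemxAr scalerDr.
rewrite !comb_affine; split; apply: eq_bigr => c _.
  by have [<- _] := hxy _ (tcL c).
by have [_ <-] := hxy _ (tcL c).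
Qed.

(** Induction on time propagates the common initial state up to time [L]; each output before [L] is
    then read off its state. *)
Lemma eq_trajectory (R : realType) (n p : nat)
    (A : 'M[R]_n) (C : 'M[R]_(p, n)) (eo : 'cV[R]_n) (ro : 'cV[R]_p)
    (L : nat) (x x' : nat -> 'cV[R]_n) (y y' : nat -> 'cV[R]_p) :
  is_trajectory A C eo ro L x y -> is_trajectory A C eo ro L x' y' ->
  x 0%N = x' 0%N ->
  (forall t, (t < L.+1)%N -> x t = x' t) /\
  (forall t, (t < L)%N -> y t = y' t).
Proof.
move=> hxy hxy' x0.
have xE t : (t < L.+1)%N -> x t = x' t.
  elim: t => // t IHt tL.
  by have [-> _] := hxy _ tL; have [-> _] := hxy' _ tL; rewrite IHt // ltnW.
split=> // t tL.
by have [_ ->] := hxy _ tL; have [_ ->] := hxy' _ tL; rewrite xE // ltnW.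
Qed.

Theorem lemma1 (R : realType) (n p L : nat)
    (hn : (1 <= n)%N) (hp : (1 <= p)%N) (hL : (1 <= L)%N)
    (A : 'M[R]_n) (C : 'M[R]_(p, n)) (eo : 'cV[R]_n) (ro : 'cV[R]_p)
    (T : nat) (hT : (L + n <= T)%N)
    (x : nat -> 'cV[R]_n) (y : nat -> 'cV[R]_p)
    (hxy : is_trajectory A C eo ro T x y)
    (hrank : \rank (col_mx (hankel 1 x 0 (T - L).+1)
                           (const_mx 1%R : 'rV[R]_(_))) = n.+1)
    (x' : nat -> 'cV[R]_n) (y' : nat -> 'cV[R]_p) :
  is_trajectory A C eo ro L x' y' <->
  exists alpha : 'cV[R]_(T - L).+1,
    col_mx (col_mx (hankel L.+1 x 0 T.+1) (hankel L y 0 T))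
           (const_mx 1 : 'rV[R]_(T - L).+1) *m alpha
    = col_mx (col_mx (stack x' 0 L.+1) (stack y' 0 L)) (const_mx 1 : 'cV[R]_1).
Proof.
(* The subtraction is not truncated, since [hT] gives [L <= T]: the window shifted by [T - L] ends
   exactly with the data. *)
have LT : (L + (T - L) = T)%N by rewrite subnKC // (leq_trans _ hT) ?leq_addr.
have comb_traj (a : 'cV_(T - L).+1) : \sum_(c < (T - L).+1) a c 0 = 1 ->
    is_trajectory A C eo ro L (shift_comb a x) (shift_comb a y).
  by apply: shift_comb_trajectory; rewrite LT.
split=> [hxy' | [a]].
  have [a x0E sum_a] := affine_span hrank (x' 0%N).
  have [xE yE] := eq_trajectory (comb_traj a sum_a) hxy' x0E.
  (* The instance is explicit because its column count [(T.+1 - L.+1).+1] matches [(T - L).+1] only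
     up to computation. *)
  exists a; rewrite !mul_col_mx (@hankel_mul _ _ L.+1 x 0 T.+1) hankel_mul.
  congr (col_mx (col_mx _ _) _); [exact/eq_stackP | exact/eq_stackP |].
  exact/const_mx1_mulP.
rewrite !mul_col_mx (@hankel_mul _ _ L.+1 x 0 T.+1) hankel_mul.
move=> /eq_col_mx[/eq_col_mx[/eq_stackP xE /eq_stackP yE] /const_mx1_mulP sum_a].
(* The state window has depth [L.+1], so [xE] also covers the successor time [t.+1]. *)
move=> t tL; have [xS yt] := comb_traj a sum_a t tL.
by rewrite -(xE t.+1 tL) -(xE t (ltnW tL)) -(yE t tL).
Qed.
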